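(* Let $P=\{p_1,\dots,p_n\}$ be a finite upper semilattice indexed so that $p_i\le p_j$ implies $i\le j$, let $\mathbf{E}=(e_{ij})$ be the $n\times n$ matrix with $e_{ij}=1$ if $p_i\le p_j$ and $0$ otherwise, and let $f,g\colon P\to\mathbb{R}$ satisfy $\mathbf{f}=\mathbf{E}\mathbf{g}$, where $\mathbf{f}=(f(p_i))_i$, $\mathbf{g}=(g(p_i))_i$. Let $\mathbf{F}=(f(p_i\vee p_j))_{i,j}$, let $P_0=\{p\in P: g(p)\ne0\}$, and let $\mathbf{F}_0$ be the principal submatrix of $\mathbf{F}$ with rows and columns indexed by the elements of $P_0$. Then $\mathbf{F}_0$ is invertible.
   Context: An upper semilattice is a poset in which every two elements $p,q$ have a least upper bound $p\vee q$. *)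

(* Defs.v *)
From HB Require Import structures.
From mathcomp Require Import all_boot all_order all_algebra.
From mathcomp Require Import reals.

Set Implicit Arguments.
Unset Strict Implicit.
Unset Printing Implicit Defensive.

Import Order.TTheory GRing.Theory Num.Theory.
Local Open Scope ring_scope.

Section SemilatticeMatrices.

Context {d : Order.disp_t} {P : finJoinSemilatticeType d} {R : realType}.
Context {n : nat} (p : 'I_n -> P).

Definition incidence_mx : 'M[R]_n :=
  \matrix_(i, j) (if (p i <= p j)%O then 1 else 0).

Definition value_vec (h : P -> R) : 'cV[R]_n := \col_i h (p i).

Definition join_mx (f : P -> R) : 'M[R]_n :=
  \matrix_(i, j) f (p i `|` p j)%O.

Definition nonzero_set (g : P -> R) : {set P} := [set x | g x != 0].

(* enum_val lists the indices in increasing order, so the submatrix keeps the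
   order of the rows and columns of A. *)
Definition principal_submx (A : 'M[R]_n) (S : {set P}) :
    'M[R]_#|p @^-1: S| :=
  mxsub enum_val enum_val A.

End SemilatticeMatrices.

(* Main.v *)
(* Every f (p_i \/ p_j) is the sum of g over the common upper bounds of p_i and
   p_j, so F = E * D * E^T with D = diag (g (p_k)).  The zeros of D drop the
   indices outside P_0, and hence F_0 = E_0 * D_0 * E_0^T for the principal
   submatrices on P_0.  There D_0 has a nonzero diagonal, and E_0 is upper
   unitriangular because the indexing is a linear extension. *)

Require Import Defs.
From HB Require Import structures.
From mathcomp Require Import all_boot all_order all_algebra.
From mathcomp Require Import reals.

Set Implicit Arguments.
Unset Strict Implicit.
Unset Printing Implicit Defensive.

Import Order.TTheory GRing.Theory Num.Theory.
Local Open Scope ring_scope.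

(** [enum A] filters the enumeration of ['I_n], whose values form [iota 0 n], so it is strictly
    sorted. Principal submatrices thus inherit triangularity. *)
Lemma enum_val_ltn (n : nat) (A : {set 'I_n}) (i j : 'I_#|A|) :
  (i < j)%N -> (enum_val i < enum_val j)%N.
Proof.
move=> lt_ij; have x0 : 'I_n := enum_val i.
have srt : sorted (fun x y : 'I_n => (x < y)%N) (enum A).
  rewrite {1}/enum_mem -enumT; apply: sorted_filter.
    by move=> x y z; apply: ltn_trans.
  by have := iota_ltn_sorted 0 n; rewrite -val_enum_ord sorted_map.
rewrite !(enum_val_nth x0).
apply: (sorted_ltn_nth _ x0 srt) ; rewrite ?inE -?cardE //.
by move=> x y z; apply: ltn_trans.
Qed.

Section JoinMatrixFactorization.

Context {d : Order.disp_t} {P : finJoinSemilatticeType d} {R : realType}.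
Context {n : nat} (p : 'I_n -> P).

Lemma join_mx_sum (f g : P -> R) (i j : 'I_n) :
    bijective p -> value_vec p f = incidence_mx p *m value_vec p g ->
  join_mx p f i j =
  \sum_k incidence_mx p i k * g (p k) * incidence_mx p j k.
Proof.
(* The inverse [q] gives the index of the join, hence the row of the hypothesis to read. *)
case=> q _ qK /matrixP /(_ (q (p i `|` p j)%O) ord0).
rewrite !mxE qK => ->; apply: eq_bigr => k _.
(* A join lies below [p k] iff both its arguments do, so its indicator is a product. *)
rewrite !mxE qK leUx.
by case: (_ <= _)%O; case: (_ <= _)%O; rewrite /= ?(mul0r, mulr0, mul1r, mulr1).
Qed.

Lemma principal_join_mxE (f g : P -> R) :
    bijective p -> value_vec p f = incidence_mx p *m value_vec p g ->
  let E0 := principal_submx p (incidence_mx p) (nonzero_set g) in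
  principal_submx p (join_mx p f) (nonzero_set g) =
  E0 *m diag_mx (\row_k g (p (enum_val k))) *m E0^T.
Proof.
move=> p_bij fEg E0; apply/matrixP=> i j.
rewrite mxE (join_mx_sum _ _ p_bij fEg) mul_mx_diag mxE.
rewrite (bigID (mem (p @^-1: nonzero_set g))) /= [X in _ + X]big1 ?addr0.
  by rewrite big_enum_val; apply: eq_bigr => k _; rewrite !mxE.
by move=> k; rewrite !inE negbK => /eqP ->; rewrite mulr0 mul0r.
Qed.

Lemma det_principal_incidence_mx (S : {set P}) :
    (forall i j : 'I_n, (p i <= p j)%O -> (i <= j)%N) ->
  \det (principal_submx p (incidence_mx p : 'M[R]_n) S) = 1.
Proof.
(* [det_trig] expects a lower triangular matrix, hence the transpose. *)
move=> p_linext; rewrite -det_tr det_trig.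
  by rewrite big1 // => i _; rewrite !mxE lexx.
apply/is_trig_mxP => i j lt_ij; rewrite !mxE ifF //.
by apply/negP => /p_linext; rewrite leqNgt enum_val_ltn.
Qed.

End JoinMatrixFactorization.

Theorem theorem6p4 (R : realType) (d : Order.disp_t)
    (P : finJoinSemilatticeType d) (n : nat) (p : 'I_n -> P)
    (p_bij : bijective p)
    (p_linext : forall i j : 'I_n, (p i <= p j)%O -> (i <= j)%N)
    (f g : P -> R)
    (fEg : value_vec p f = incidence_mx p *m value_vec p g) :
  principal_submx p (join_mx p f) (nonzero_set g) \in unitmx.
Proof.
rewrite (principal_join_mxE p_bij fEg) unitmxE !det_mulmx det_tr.
(* What remains is the product of [g] over [nonzero_set g]. *)
rewrite det_principal_incidence_mx // mul1r mulr1 det_diag unitfE.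
apply/prodf_neq0 => k _; rewrite mxE.
by have := enum_valP k; rewrite !inE.
Qed.
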